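(* Let $K_{1,n}$ be a directed edge-labeled star graph with central vertex $v_0$ and edge labels $Z_1,\dots,Z_k$ of multiplicities $m_1\ge\cdots\ge m_k$. Let $p$ be the largest index with $m_p>1$ ($p=0$ if there is none). Let the end vertices be $v_{i,j}$, $1\le i\le k$, $1\le j\le m_i$, where the edge joining $v_0$ and $v_{i,j}$ has label $Z_i$, and let $\delta(v_{i,j})=+1$ if this edge is directed from $v_0$ to $v_{i,j}$ and $\delta(v_{i,j})=-1$ if it is directed from $v_{i,j}$ to $v_0$. Then a basis of the abelian factor of $\mathfrak{n}_{K_{1,n}}$ is given by $$A=\bigcup_{i=1}^{p}\bigcup_{j=1}^{m_i-1}\left\{\delta(v_{i,m_i})\,v_{i,j}-\delta(v_{i,j})\,v_{i,m_i}\right\},$$ and an orthonormal basis for the orthogonal complement $\mathcal{Z}(\mathfrak{n}_{K_{1,n}})^{\perp}$ of the center is given by $$S=\{v_0\}\cup\bigcup_{i=1}^{k}\left\{\frac{1}{\sqrt{m_i}}\left(\delta(v_{i,1})v_{i,1}+\delta(v_{i,2})v_{i,2}+\cdots+\delta(v_{i,m_i})v_{i,m_i}\right)\right\}.$$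
   Context: A directed edge-labeled graph $G=(V,E,C)$ is a finite connected directed graph with vertex set $V=\{v_1,\dots,v_n\}$ and edge set $E$, together with a surjective labeling $c:E\to C=\{Z_1,\dots,Z_p\}$ (labels may be repeated on different edges). An edge directed from $v$ to $w$ is written $(v,w)$. The metric Lie algebra $\mathfrak{n}_G$: as a real vector space $\mathfrak{n}_G=\mathfrak{v}\oplus\mathfrak{w}$, where $\mathfrak{v}$ has basis $V$ and $\mathfrak{w}$ has basis $C$; the inner product makes $V\cup C$ an orthonormal basis. The bracket is bilinear and skew-symmetric with $[v_i,v_j]=\sum_{\ell}(\epsilon_\ell-\epsilon'_\ell)Z_\ell$, where $\epsilon_\ell=1$ if $c(v_i,v_j)=Z_\ell$ and $0$ otherwise, and $\epsilon'_\ell=1$ if $c(v_j,v_i)=Z_\ell$ and $0$ otherwise; all other brackets of basis elements are zero. For a simple graph the derived algebra is $[\mathfrak{n}_G,\mathfrak{n}_G]=\mathfrak{w}$. The abelian factor of $\mathfrak{n}_G$ is the unique subspace $\mathfrak{a}\subseteq\mathfrak{v}$ such that the center satisfies $\mathcal{Z}(\mathfrak{n}_G)=[\mathfrak{n}_G,\mathfrak{n}_G]\oplus\mathfrak{a}$. The star graph $K_{1,n}$ consists of a central vertex $v_0$ joined by one edge to each of $n\ge 1$ end vertices. The multiplicity of a label is the number of edges carrying it. Thus in $\mathfrak{n}_{K_{1,n}}$ one has $[v_0,v_{i,j}]=\delta(v_{i,j})Z_i$. *)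

(* Defs.v *)
From HB Require Import structures.
From mathcomp Require Import all_boot all_order all_algebra.
From mathcomp Require Import sesquilinear.
From mathcomp Require Import reals.

Set Implicit Arguments.
Unset Strict Implicit.
Unset Printing Implicit Defensive.

Import Order.TTheory GRing.Theory Num.Theory.
Local Open Scope ring_scope.

(* The edge set E is contained in V * V, and the partial map [label] encodes  *)
(* both E and c : E -> C: there is an edge (u, w) iff [label u w] is not      *)
(* [None], and [label u w = Some z] means c(u, w) = z.                        *)
Record elgraph (V C : finType) := ELGraph {
  label : V -> V -> option C;
  elgraph_connected :
    forall u w, connect [rel a b | label a b || label b a] u w;
  elgraph_label_surj : forall z, exists u w, label u w = Some z
}.

Definition arc (V C : finType) (G : elgraph V C) : rel V :=
  fun u w => isSome (label G u w).

Definition multiplicity (V C : finType) (G : elgraph V C) (z : C) : nat :=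
  #|[set e : V * V | label G e.1 e.2 == Some z]|.

(* Each vertex other than v0 is joined to v0 by exactly one edge (in exactly  *)
(* one direction), and every edge joins v0 to another vertex.                 *)
Definition is_star (V C : finType) (G : elgraph V C) (v0 : V) (n : nat) :=
  [/\ #|V| = n.+1,
      forall w, w != v0 -> arc G v0 w (+) arc G w v0
    & forall u w, arc G u w -> (u == v0) (+) (w == v0)].

(* v i j, for j < m i, are the end vertices, each listed once; indices start  *)
(* at 0, and the values v i j with m i <= j are irrelevant.                   *)
Definition end_vertex_labeling (V C : finType) (G : elgraph V C) (v0 : V)
    (k : nat) (Z : 'I_k -> C) (m : 'I_k -> nat) (v : 'I_k -> nat -> V) :=
  [/\ forall i j, (j < m i)%N -> v i j != v0,
      forall w, w != v0 -> exists i, exists2 j, (j < m i)%N & w = v i j,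
      forall i j i' j', (j < m i)%N -> (j' < m i')%N -> v i j = v i' j' ->
        i = i' /\ j = j'
    & forall i j, (j < m i)%N ->
        label G v0 (v i j) = Some (Z i) \/ label G (v i j) v0 = Some (Z i)].

Definition edge_sign (R : realType) (V C : finType) (G : elgraph V C)
    (v0 w : V) : R := if arc G v0 w then 1 else -1.

(* The space v (+) w: functions giving the coordinates in the basis V u C.    *)
Notation lie_space R V C := {ffun (V + C)%type -> R^o}.

Section LieAlgebra.
Variables (R : realType) (V C : finType).
Local Notation L := (lie_space R V C).
Implicit Types (x y z : L) (U : {vspace L}).

Definition basis_vec (i : V + C) : L := [ffun j => (j == i)%:R].
Definition vtx (w : V) : L := basis_vec (inl w).
Definition lbl (z : C) : L := basis_vec (inr z).

Definition vtx_space : {vspace L} := <<[seq vtx w | w <- enum V]>>%VS.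

Definition inner x y : R := \sum_i x i * y i.

Variable G : elgraph V C.

Definition basis_bracket (i j : V + C) : L :=
  match i, j with
  | inl u, inl w =>
      \sum_z ((label G u w == Some z)%:R - (label G w u == Some z)%:R) *: lbl z
  | _, _ => 0
  end.

Definition bracket x y : L := \sum_i \sum_j (x i * y j) *: basis_bracket i j.

Lemma basis_vec_sum x : x = \sum_i x i *: basis_vec i.
Proof.
apply/ffunP => i; rewrite sum_ffunE (bigD1 i) //= big1 => [|j ji].
  by rewrite !ffunE eqxx addr0 [RHS]mulr1.
by rewrite !ffunE eq_sym (negPf ji) [LHS]mulr0.
Qed.

Lemma inner_bilinear : bilinear_for *%R *%R inner.
Proof.
split=> u a x y; rewrite /= /inner mulr_sumr -big_split; apply: eq_bigr => i _ /=.
  by rewrite !ffunE mulrDl -mulrA.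
by rewrite !ffunE mulrDr mulrCA.
Qed.
HB.instance Definition _ :=
  bilinear_isBilinear.Build R L L R *%R *%R inner inner_bilinear.

Lemma inner_sym x y : inner x y = (-1) ^+ false * idfun (inner y x).
Proof. by rewrite mul1r; apply: eq_bigr => i _; rewrite mulrC. Qed.
HB.instance Definition _ :=
  isHermitianSesquilinear.Build R L false idfun inner inner_sym.

Lemma inner_gt0 x : x != 0 -> 0 < inner x x.
Proof.
move=> x0; rewrite lt0r sumr_ge0 ?andbT => [|i _]; last exact: sqr_ge0.
apply: contra x0; rewrite psumr_eq0 => [/allP s0|i _]; last exact: sqr_ge0.
apply/eqP/ffunP => i; rewrite ffunE; apply/eqP.
by have := s0 i (mem_index_enum i); rewrite mulf_eq0 orbb.
Qed.
HB.instance Definition _ := isDotProduct.Build R L inner inner_gt0.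

Definition inner_form : {dot L for idfun} := inner.

Lemma inner_basis_vec i j : inner (basis_vec i) (basis_vec j) = (i == j)%:R.
Proof.
rewrite /inner (bigD1 i) //= big1 => [|l li].
  by rewrite !ffunE eqxx addr0 mul1r.
by rewrite !ffunE (negPf li) mul0r.
Qed.

Lemma bracket_bilinear : bilinear_for *:%R *:%R bracket.
Proof.
split=> u a x y; rewrite /= /bracket scaler_sumr -big_split; apply: eq_bigr => i _;
  rewrite scaler_sumr -big_split; apply: eq_bigr => j _ /=;
  rewrite !ffunE scalerA -scalerDl; congr (_ *: _).
  by rewrite mulrDl mulrA.
by rewrite mulrDr mulrCA.
Qed.
HB.instance Definition _ :=
  bilinear_isBilinear.Build R L L L *:%R *:%R bracket bracket_bilinear.

Lemma bracket_basis_vec i j :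
  bracket (basis_vec i) (basis_vec j) = basis_bracket i j.
Proof.
rewrite /bracket (bigD1 i) //= (bigD1 j) //= big1 => [|l lj].
  rewrite big1 => [|l li].
    by rewrite !ffunE !eqxx mulr1 scale1r !addr0.
  by apply: big1 => l' _; rewrite !ffunE (negPf li) mul0r scale0r.
by rewrite !ffunE (negPf lj) mulr0 scale0r.
Qed.

Lemma bracket_skew x y : bracket x y = - bracket y x.
Proof.
rewrite /bracket exchange_big -sumrN; apply: eq_bigr => i _.
rewrite -sumrN; apply: eq_bigr => j _; rewrite -scalerN mulrC.
congr (_ *: _); case: i j => [u|c] [w|d] /=; rewrite ?oppr0 // -sumrN.
by apply: eq_bigr => c _; rewrite -scaleNr opprB.
Qed.

Lemma bracket_bracket x y z : bracket (bracket x y) z = 0.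
Proof.
apply: big1 => -[u|c] _; apply: big1 => -[w|d] _; rewrite ?scaler0 //.
suff -> : bracket x y (inl u) = 0 by rewrite mul0r scale0r.
rewrite /bracket sum_ffunE big1 // => i _; rewrite sum_ffunE big1 // => j _.
rewrite ffunE; case: i j => [a|a] [b|b] /=; rewrite ?ffunE ?[LHS]mulr0 //.
by rewrite sum_ffunE big1 ?[LHS]mulr0 // => c _; rewrite !ffunE [LHS]mulr0.
Qed.

Lemma bracket_jacobi x y z :
  bracket x (bracket y z) + bracket y (bracket z x)
    + bracket z (bracket x y) = 0.
Proof. by rewrite !(bracket_skew _ (bracket _ _)) !bracket_bracket oppr0 !addr0. Qed.

Definition center : {vspace L} :=
  (\bigcap_(i : V + C) lker (linfun (applyr bracket (basis_vec i))))%VS.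

Lemma centerP x : reflect (forall y, bracket x y = 0) (x \in center).
Proof.
apply: (iffP idP) => [xZ y|x0]; last first.
  rewrite memvE; apply/subv_bigcapP => i _.
  by rewrite -memvE memv_ker lfunE /=; apply/eqP/x0.
rewrite (basis_vec_sum y) linear_sumr big1 // => i _.
move: xZ; rewrite memvE => /subv_bigcapP/(_ i isT).
rewrite -memvE memv_ker lfunE /= => /eqP xi0.
by rewrite linearZr_LR /= xi0 scaler0.
Qed.

Definition derived : {vspace L} :=
  <<[seq bracket (basis_vec i) (basis_vec j)
      | i <- enum [set: V + C], j <- enum [set: V + C]]>>%VS.

Lemma derived_subvP U :
  reflect (forall x y, bracket x y \in U) (derived <= U)%VS.
Proof.
apply: (iffP span_subvP) => [sU x y|sU _ /allpairsP[p [_ _ ->]]]; last exact: sU.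
rewrite (basis_vec_sum x) (basis_vec_sum y) linear_sumr rpred_sum // => j _.
rewrite linear_sumlz rpred_sum // => i _.
rewrite linearZr_LR linearZl_LR !rpredZ // sU //.
by apply/allpairsP; exists (i, j); rewrite !mem_enum !inE.
Qed.

Definition is_abelian_factor (a : {vspace L}) :=
  [/\ (a <= vtx_space)%VS, center = (derived + a)%VS & directv (derived + a)].

End LieAlgebra.

(* Main.v *)
Require Import Defs.
From mathcomp Require Import all_boot all_order all_algebra.
From mathcomp Require Import sesquilinear.
From mathcomp Require Import reals.

Set Implicit Arguments.
Unset Strict Implicit.
Unset Printing Implicit Defensive.

Import Order.TTheory GRing.Theory Num.Theory.
Local Open Scope ring_scope.

(** Pairing a vector with the unnormalised sums
    [s i = \sum_j d (v i j) *: e (v i j)] detects the center.  In the star,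
    [[x, e (v i j)]] is [d (v i j)] times the [v0]-coordinate of [x], in the
    direction [lbl (Z i)], and [[x, e v0]] has the coordinate [- inner x (s i)]
    along [lbl (Z i)], because bijectivity of [Z] keeps the different labels
    apart.  Hence [x] is central iff it is orthogonal to [e v0] and to every
    [s i] (mem_center_star).

    Both bases are then instances of one principle (basis_of_biorthogonal):
    vectors [f i] of [U] and vectors [g j] with [form (f i) (g j) = (i == j)],
    such that only [0] in [U] is orthogonal to every [g j], make [f] a basis
    of [U].

    For the orthogonal complement of the center, [f = g] is the family of
    [e v0] and the normalised [s i]: a vector orthogonal to this family is
    central, so it vanishes if it is also orthogonal to the center.

    The abelian factor of any graph must be the center intersected with the
    vertex space, because brackets have no vertex coordinate
    (abelian_factorE); and this intersection is an abelian factor as soon as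
    every label is in the derived algebra.  In it, the equation
    [inner x (s i) = 0] determines the coordinate of [x] at the last leaf with
    label [Z i] from those at the other ones, which can be chosen freely.  So
    the vectors of [A] are dual, up to a sign, to the coordinates at the
    leaves that are not last for their label. *)

(** * Biorthogonal families *)

(** The pairings with the [g j] recover the coefficients of a combination of
    the [f i]; so [f] is free, and subtracting [\sum_i form x (g i) *: f i]
    from [x] leaves a vector that [g] does not see. *)
Lemma basis_of_biorthogonal (F : fieldType) (eps : bool)
    (theta : {rmorphism F -> F}) (vT : vectType F)
    (form : {hermitian vT for eps & theta}) (U : {vspace vT})
    (I : eqType) (r : seq I) (f g : I -> vT) :
  uniq r ->
  {in r, forall i, f i \in U} ->
  {in r &, forall i j, form (f i) (g j) = (i == j)%:R} ->
  (forall x, x \in U -> {in r, forall j, form x (g j) = 0} -> x = 0) ->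
  basis_of U [seq f i | i <- r].
Proof.
move=> uniq_r fU fg sepU.
have pair_sum (c : I -> F) : {in r, forall j,
    form (\sum_(i <- r) c i *: f i) (g j) = c j}.
  move=> j jr; rewrite linear_sumlz (bigD1_seq j) //= linearZl_LR /= fg // eqxx.
  rewrite mulr1 big_seq_cond big1 ?addr0 // => i /andP[ir ij].
  by rewrite linearZl_LR /= fg // (negPf ij) mulr0.
rewrite /basis_of; apply/andP; split; last first.
  elim: r uniq_r fg {fU sepU pair_sum} => [|i r IHr] /=.
    by rewrite nil_free.
  case/andP=> ir uniq_r fg; rewrite free_cons IHr ?andbT //; last first.
    by move=> a b ar br; rewrite fg ?inE ?ar ?br ?orbT.
  have sub_perp : (<<[seq f j | j <- r]>> <= orthov form <[g i]>)%VS.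
    apply/span_subvP => _ /mapP[j jr ->].
    rewrite mem_orthov1 fg ?mem_head ?inE ?jr ?orbT //.
    by case: (eqVneq i j) jr ir => // <- ->.
  apply/negP => /(subvP sub_perp).
  by rewrite mem_orthov1 fg ?mem_head // eqxx oner_eq0.
rewrite eqEsubv; apply/andP; split.
  by apply/span_subvP => _ /mapP[i ir ->]; apply: fU.
apply/subvP => x xU.
suff -> : x = \sum_(i <- r) form x (g i) *: f i.
  rewrite big_seq; apply: rpred_sum => i ir.
  by apply/rpredZ/memv_span/map_f.
apply/eqP; rewrite -subr_eq0; apply/eqP/sepU => [|j jr].
  by rewrite rpredB // big_seq rpred_sum // => i ir; rewrite rpredZ ?fU.
by rewrite linearBl /= pair_sum ?subrr.
Qed.

(** Indexing lets the hypothesis compare indices, which are known to be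
    distinct, rather than the vectors themselves. *)
Lemma orthonormal_map (F : fieldType) (eps : bool)
    (theta : {rmorphism F -> F}) (vT : vectType F)
    (form : {hermitian vT for eps & theta})
    (I : eqType) (r : seq I) (f : I -> vT) :
  uniq r ->
  {in r &, forall i j, form (f i) (f j) = (i == j)%:R} ->
  orthonormal form [seq f i | i <- r].
Proof.
elim: r => [//|i r IHr] /= /andP[ir uniq_r] ff; rewrite /orthonormal /=.
have /andP[-> ->] : orthonormal form [seq f i | i <- r].
  by apply: IHr => // a b ar br; rewrite ff ?inE ?ar ?br ?orbT.
rewrite ff ?mem_head // !eqxx !andbT; apply/allP => _ /mapP[j jr ->] /=.
rewrite ff ?mem_head ?inE ?jr ?orbT //.
by case: (eqVneq i j) jr ir => // <- ->.
Qed.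

(** * The Lie algebra of an arbitrary graph *)

Section LieCoordinates.
Variables (R : realType) (V C : finType).
Implicit Type x : lie_space R V C.

Lemma inner_basis_vecr x i : inner x (basis_vec R i) = x i.
Proof.
rewrite /inner (bigD1 i) //= big1 => [|j ji].
  by rewrite !ffunE eqxx addr0 mulr1.
by rewrite !ffunE (negPf ji) mulr0.
Qed.

Lemma mem_vtx_space x :
  reflect (forall z, x (inr z) = 0) (x \in vtx_space R V C).
Proof.
apply: (iffP idP) => [|x0].
  have sub z : (vtx_space R V C
      <= orthov (inner_form R V C) <[lbl R V z]>)%VS.
    apply/span_subvP => _ /mapP[w _ ->].
    by rewrite mem_orthov1 /= inner_basis_vec.
  move=> xV z; move/subvP: (sub z) => /(_ x xV).
  by rewrite mem_orthov1 /= inner_basis_vecr => /eqP.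
rewrite (basis_vec_sum x) big_sumType /= [X in _ + X]big1 ?addr0 => [|z _].
  apply: rpred_sum => w _; apply/rpredZ/memv_span/map_f.
  by rewrite mem_enum.
by rewrite x0 scale0r.
Qed.

Lemma bracket_basis_vecr (G : elgraph V C) x b :
  bracket G x (basis_vec R b) = \sum_a x a *: basis_bracket R G a b.
Proof.
rewrite {1}(basis_vec_sum x) linear_sumlz; apply: eq_bigr => a _.
by rewrite linearZl_LR /= bracket_basis_vec.
Qed.

Lemma bracket_vtxr (G : elgraph V C) x w :
  bracket G x (vtx R C w) =
    \sum_u x (inl u) *: basis_bracket R G (inl u) (inl w).
Proof.
rewrite bracket_basis_vecr big_sumType /= [X in _ + X]big1 ?addr0 // => z _.
by rewrite scaler0.
Qed.

Lemma bracket_inl (G : elgraph V C) x y u : bracket G x y (inl u) = 0.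
Proof.
rewrite /bracket sum_ffunE big1 // => i _; rewrite sum_ffunE big1 // => j _.
rewrite ffunE; case: i j => [a|a] [b|b] /=; rewrite ?ffunE ?[LHS]mulr0 //.
by rewrite sum_ffunE big1 ?[LHS]mulr0 // => c _; rewrite !ffunE [LHS]mulr0.
Qed.

Lemma derived_inl (G : elgraph V C) x u : x \in derived R G -> x (inl u) = 0.
Proof.
suff /subvP sub : (derived R G <= orthov (inner_form R V C) <[vtx R C u]>)%VS.
  by move=> /sub; rewrite mem_orthov1 /= inner_basis_vecr => /eqP.
apply/derived_subvP => y z.
by rewrite mem_orthov1 /= inner_basis_vecr bracket_inl.
Qed.

Lemma derived_cap_vtx (G : elgraph V C) x :
  x \in derived R G -> x \in vtx_space R V C -> x = 0.
Proof.
move=> xD /mem_vtx_space xV; apply/ffunP => -[u|z]; rewrite [RHS]ffunE //.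
exact: derived_inl xD.
Qed.

Lemma derived_sub_center (G : elgraph V C) : (derived R G <= center R G)%VS.
Proof.
by apply/derived_subvP => x y; apply/centerP => z; apply: bracket_bracket.
Qed.

(** Modular law: if a central vector of the vertex space splits into a derived
    part and a part in [a], both the vector and its second part lie in the
    vertex space, so the derived part does too and is zero. *)
Lemma abelian_factorE (G : elgraph V C) a :
  is_abelian_factor G a -> a = (center R G :&: vtx_space R V C)%VS.
Proof.
case=> aV cE _; apply/eqP; rewrite eqEsubv subv_cap aV cE addvSr /=.
apply/subvP => x /memv_capP[/memv_addP[y yD [z za ->]] xV].
suff -> : y = 0 by rewrite add0r.
apply: (derived_cap_vtx yD); rewrite -(addrK z y) rpredB //.
exact: subvP aV _ za.
Qed.

(** Once the labels are in the derived algebra, hence central, the label part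
    of a central vector can be split off, leaving a central vector of the
    vertex space. *)
Lemma unique_abelian_factor (G : elgraph V C) :
  (forall z, lbl R V z \in derived R G) ->
  unique (is_abelian_factor G) (center R G :&: vtx_space R V C)%VS.
Proof.
move=> lblD; split=> [|a /abelian_factorE -> //].
split; first exact: capvSr.
  apply/eqP; rewrite eqEsubv subv_add derived_sub_center capvSl !andbT.
  apply/subvP => x xZ; pose y := \sum_z x (inr z) *: lbl R V z.
  have yD : y \in derived R G by apply: rpred_sum => z _; rewrite rpredZ.
  rewrite -(subrKC y x) memv_add // memv_cap rpredB //=; last first.
    exact: subvP (derived_sub_center G) _ yD.
  rewrite /y {1}(basis_vec_sum x) big_sumType /= addrK.
  apply/rpred_sum => w _; apply/rpredZ/memv_span/map_f.
  by rewrite mem_enum.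
apply/directv_addP/eqP; rewrite -subv0; apply/subvP => x.
rewrite memv0 => /memv_capP[xD /memv_capP[_ xV]].
by rewrite (derived_cap_vtx xD xV).
Qed.

End LieCoordinates.

(** * The center of the Lie algebra of a star *)

Section Star.
Variables (R : realType) (V C : finType) (G : elgraph V C).
Variables (v0 : V) (n k : nat) (Z : 'I_k -> C) (v : 'I_k -> nat -> V).
Hypothesis n_gt0 : (0 < n)%N.
Hypothesis starG : is_star G v0 n.
Hypothesis Z_bij : bijective Z.
Local Notation m i := (multiplicity G (Z i)).
Hypothesis v_lab : end_vertex_labeling G v0 Z (fun i => m i) v.
Local Notation L := (lie_space R V C).
Local Notation d w := (edge_sign R G v0 w).
Local Notation e w := (vtx R C w).
Implicit Type x : L.

Definition leaf_sum i : L := \sum_(j < m i) d (v i j) *: e (v i j).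

Lemma edge_sign_sqr w : d w * d w = 1.
Proof. by rewrite /edge_sign; case: ifP => _; rewrite ?mulrNN mulr1. Qed.

Lemma multiplicity_gt0 z : (0 < multiplicity G z)%N.
Proof.
have [u [w uw]] := elgraph_label_surj G z.
by apply/card_gt0P; exists (u, w); rewrite inE /= uw.
Qed.

Lemma last_leaf_lt i : ((m i).-1 < m i)%N.
Proof. by rewrite ltn_predL multiplicity_gt0. Qed.

Lemma star_bracket_center i j : (j < m i)%N ->
  basis_bracket R G (inl v0) (inl (v i j)) = d (v i j) *: lbl R V (Z i).
Proof.
move=> jm; have [v_neq0 _ _ lab] := v_lab; have [_ orient _] := starG.
have := orient _ (v_neq0 i j jm).
have sumE (a : R) (b : C) : \sum_z (a * (Some b == Some z)%:R) *: lbl R V z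
    = a *: lbl R V b.
  rewrite (bigD1 b) //= eqxx mulr1 big1 ?addr0 // => z zb.
  by rewrite (inj_eq Some_inj) eq_sym (negPf zb) mulr0 scale0r.
rewrite /edge_sign /= -sumE; case: (lab i j jm) => lij; rewrite /Defs.arc lij.
  case: (label G (v i j) v0) => //= _; apply: eq_bigr => z _.
  by rewrite subr0 mul1r.
case: (label G v0 (v i j)) => //= _; apply: eq_bigr => z _.
by rewrite sub0r mulN1r.
Qed.

(** An edge of a star has exactly one end at [v0]. *)
Lemma star_bracket_eq0 u w : (u == v0) = (w == v0) ->
  basis_bracket R G (inl u) (inl w) = 0.
Proof.
have [_ _ arcs] := starG => uw; apply: big1 => z _.
have noarc a b : (a == v0) = (b == v0) -> label G a b = None.
  move=> ab; have := arcs a b; rewrite /Defs.arc ab addbb.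
  by case: (label G a b) => // c /(_ isT).
by rewrite !noarc // subrr scale0r.
Qed.

(** Listing the leaves by label turns sums over the vertices into the double
    sums over labels and leaves that occur in the brackets. *)
Lemma perm_vertices :
  perm_eq (index_enum V)
    (v0 :: [seq v i j | i <- index_enum 'I_k, j <- iota 0 (m i)]).
Proof.
have [v_neq0 v_surj v_inj _] := v_lab.
apply: uniq_perm; rewrite ?index_enum_uniq //=.
  rewrite allpairs_uniq_dep ?index_enum_uniq ?andbT //.
  - apply/allpairsPdep => -[i [j []]]; rewrite mem_iota => _ /= jm.
    by move/esym/eqP; rewrite (negPf (v_neq0 i j jm)).
  - by move=> i _; rewrite iota_uniq.
  move=> /= ? ? /allpairsPdep[i [j [_ jm ->]]].
  move=> /allpairsPdep[i' [j' [_ jm' ->]]] /=.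
  move: jm jm'; rewrite !mem_iota /= => jm jm' /(v_inj _ _ _ _ jm jm').
  by case=> -> ->.
move=> w; rewrite mem_index_enum inE; apply/esym.
have [//|/v_surj[i [j jm ->]] /=] := eqVneq w v0.
by apply/allpairsPdep; exists i, j; rewrite mem_index_enum mem_iota.
Qed.

Lemma sum_vertices (M : nmodType) (F : V -> M) :
  \sum_u F u = F v0 + \sum_i \sum_(j < m i) F (v i j).
Proof.
rewrite (perm_big _ perm_vertices) big_cons big_allpairs_dep; congr (_ + _).
apply: eq_bigr => i _.
by rewrite -(big_mkord xpredT (fun j => F (v i j))) /index_iota subn0.
Qed.

Lemma bracket_vtx0 x :
  bracket G x (e v0) =
    - \sum_i (\sum_(j < m i) d (v i j) * x (inl (v i j))) *: lbl R V (Z i).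
Proof.
rewrite bracket_vtxr sum_vertices star_bracket_eq0 // scaler0 add0r -sumrN.
apply: eq_bigr => i _; rewrite scaler_suml -sumrN; apply: eq_bigr => j _.
rewrite -bracket_basis_vec bracket_skew bracket_basis_vec.
rewrite star_bracket_center //.
by rewrite scalerN scalerA mulrC.
Qed.

Lemma bracket_leaf x i j : (j < m i)%N ->
  bracket G x (e (v i j)) = (d (v i j) * x (inl v0)) *: lbl R V (Z i).
Proof.
move=> jm; have [v_neq0 _ _ _] := v_lab.
rewrite bracket_vtxr (bigD1 v0) // star_bracket_center // big1 => [|u u0].
  by rewrite [LHS]addr0 scalerA mulrC.
by rewrite star_bracket_eq0 ?scaler0 // (negPf u0) (negPf (v_neq0 i j jm)).
Qed.

Lemma lbl_derived z : lbl R V z \in derived R G.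
Proof.
have [Z' _ ZK] := Z_bij; rewrite -[z]ZK; set i := Z' z.
have /derived_subvP/(_ (e v0) (e (v i 0))) := subvv (derived R G).
rewrite bracket_basis_vec star_bracket_center ?multiplicity_gt0 //.
by move/(rpredZ (d (v i 0))); rewrite scalerA edge_sign_sqr scale1r.
Qed.

Lemma inner_leaf_sum x i :
  inner x (leaf_sum i) = \sum_(j < m i) d (v i j) * x (inl (v i j)).
Proof.
rewrite linear_sumr; apply: eq_bigr => j _.
by rewrite linearZr_LR /= inner_basis_vecr.
Qed.

(** A nonempty star has some leaf, and the bracket with it reads off the
    [v0]-coordinate; the bracket with [e v0] reads off the pairings with the
    leaf sums.  These brackets and those with labels exhaust the basis. *)
Lemma mem_center_star x :
  reflect (x (inl v0) = 0 /\ forall i, inner x (leaf_sum i) = 0)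
    (x \in center R G).
Proof.
apply: (iffP idP) => [/centerP xZ|[x0 xs]]; last first.
  rewrite memvE; apply/subv_bigcapP => -[u|z] _;
    rewrite -memvE memv_ker lfunE /=.
    have [v_neq0 v_surj _ _] := v_lab.
    have [->|/v_surj[i [j jm ->]]] := eqVneq u v0.
      rewrite -/(e v0) bracket_vtx0 big1 ?oppr0 // => i _.
      by rewrite -inner_leaf_sum xs scale0r.
    by rewrite -/(e (v i j)) bracket_leaf // x0 mulr0 scale0r.
  rewrite bracket_basis_vecr big1 // => a _.
  by case: a => a; rewrite /= scaler0.
split.
  have [cardV _ _] := starG; have [_ v_surj _ _] := v_lab.
  have /card_gt0P[w] : (0 < #|predC1 v0|)%N.
    by rewrite cardC1 cardV.
  move=> /v_surj[i [j jm _]].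
  have := xZ (e (v i j)); rewrite bracket_leaf //.
  move/ffunP/(_ (inr (Z i))); rewrite !ffunE eqxx [LHS]mulr1.
  by move/(congr1 ( *%R (d (v i j)))); rewrite mulr0 mulrA edge_sign_sqr mul1r.
move=> i; have := xZ (e v0); rewrite bracket_vtx0 => /eqP.
rewrite oppr_eq0 => /eqP/ffunP/(_ (inr (Z i))).
rewrite sum_ffunE (bigD1 i) //= [X in _ + X]big1 ?addr0 => [|i' ii']; last first.
  rewrite !ffunE (inj_eq inr_inj) (bij_eq Z_bij) eq_sym.
  by rewrite (negPf ii') [LHS]mulr0.
by rewrite !ffunE eqxx [LHS]mulr1 inner_leaf_sum.
Qed.

Lemma leaf_eq i j i' j' : (j < m i)%N -> (j' < m i')%N ->
  (v i j == v i' j') = (i == i') && (j == j').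
Proof.
have [_ _ v_inj _] := v_lab => jm jm'.
by apply/eqP/andP => [/(v_inj _ _ _ _ jm jm')[-> ->]|[/eqP-> /eqP->]].
Qed.

Lemma leaf_sum_leaf i i' j : (j < m i')%N ->
  leaf_sum i (inl (v i' j)) = (i == i')%:R * d (v i' j).
Proof.
move=> jm; rewrite /leaf_sum sum_ffunE.
have [ii'|ii'] := eqVneq i i'.
  subst i'; rewrite (bigD1 (Ordinal jm)) //= big1 => [|j' jj'].
    by rewrite !ffunE eqxx addr0 mul1r [LHS]mulr1.
  rewrite !ffunE (inj_eq inl_inj) leaf_eq // eqxx eq_sym /=.
  by rewrite (negPf (jj' : (val j' != j))) [LHS]mulr0.
rewrite mul0r big1 // => j' _; rewrite !ffunE (inj_eq inl_inj) leaf_eq //.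
by rewrite eq_sym (negPf ii') [LHS]mulr0.
Qed.

Lemma leaf_sum_center i : leaf_sum i (inl v0) = 0.
Proof.
have [v_neq0 _ _ _] := v_lab.
rewrite /leaf_sum sum_ffunE big1 // => j _; rewrite !ffunE (inj_eq inl_inj).
by rewrite eq_sym (negPf (v_neq0 _ _ _)) ?[LHS]mulr0.
Qed.

Lemma inner_leaf_sums i i' :
  inner (leaf_sum i) (leaf_sum i') = (i == i')%:R * (m i)%:R.
Proof.
rewrite inner_leaf_sum.
under eq_bigr => j _ do rewrite leaf_sum_leaf // mulrCA edge_sign_sqr mulr1.
rewrite sumr_const card_ord.
by case: eqVneq => [->|]; rewrite ?mul1r // mul0rn mul0r.
Qed.

(** * The orthonormal basis of the orthogonal complement *)

Definition star_frame (o : option 'I_k) : L :=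
  if o is Some i then (Num.sqrt (m i)%:R)^-1 *: leaf_sum i else e v0.

Lemma inner_star_frame o o' :
  inner (star_frame o) (star_frame o') = (o == o')%:R.
Proof.
have inner0 i : inner (leaf_sum i) (e v0) = 0.
  by rewrite inner_basis_vecr leaf_sum_center.
case: o o' => [i|] [i'|] /=.
- rewrite linearZl_LR linearZr_LR /= inner_leaf_sums (inj_eq Some_inj).
  case: eqVneq => [<-|_]; rewrite ?mul0r ?mulr0 // mul1r.
  rewrite -{3}(@sqr_sqrtr _ (m i)%:R) // expr2 mulKf ?mulVf //;
  by rewrite sqrtr_eq0 -ltNge ltr0n multiplicity_gt0.
- by rewrite linearZl_LR /= inner0 mulr0.
- by rewrite inner_sym mul1r /= linearZl_LR /= inner0 mulr0.
- by rewrite inner_basis_vec !eqxx.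
Qed.

(** An explicit order, because the enumeration of the option type need not
    start with [None]. *)
Definition frame_indices : seq (option 'I_k) :=
  None :: [seq Some i | i <- enum 'I_k].

Lemma uniq_frame_indices : uniq frame_indices.
Proof.
rewrite /= map_inj_uniq ?enum_uniq ?andbT; last exact: Some_inj.
by apply/negP => /mapP[].
Qed.

Lemma mem_frame_indices o : o \in frame_indices.
Proof. by case: o => [i|//]; rewrite inE map_f ?mem_enum. Qed.

Lemma mem_center_frame x :
  reflect (forall o, inner x (star_frame o) = 0) (x \in center R G).
Proof.
apply: (iffP (mem_center_star x)) => [[x0 xs] [i|] /=|xf].
- by rewrite linearZr_LR /= xs mulr0.
- by rewrite inner_basis_vecr.
split=> [|i]; first by have /= := xf None; rewrite inner_basis_vecr.
have /eqP/= := xf (Some i); rewrite linearZr_LR /= mulf_eq0 invr_eq0 sqrtr_eq0.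
by rewrite leNgt ltr0n multiplicity_gt0 => /eqP.
Qed.

Lemma star_frame_basis :
  basis_of (orthov (inner_form R V C) (center R G))
    [seq star_frame o | o <- frame_indices].
Proof.
apply: (basis_of_biorthogonal (form := inner_form R V C) (g := star_frame)).
- exact: uniq_frame_indices.
- move=> o _; apply/mem_orthovP => x /mem_center_frame xf /=.
  by rewrite inner_sym mul1r /= xf.
- by move=> o o' _ _; apply: inner_star_frame.
move=> x /mem_orthovP xZ xf.
apply/eqP/negP => /negP /inner_gt0; rewrite [inner x x]xZ ?ltxx //.
by apply/mem_center_frame => o; apply: xf; rewrite mem_frame_indices.
Qed.

Lemma star_frame_orthonormal :
  orthonormal (inner_form R V C) [seq star_frame o | o <- frame_indices].
Proof.
by apply: orthonormal_map => [|o o' _ _]; rewrite ?uniq_frame_indices //;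
  apply: inner_star_frame.
Qed.

(** * The basis of the abelian factor *)

Lemma inner_leaf x i j : inner x (e (v i j)) = x (inl (v i j)).
Proof. exact: inner_basis_vecr. Qed.

Definition leaf_relation (t : 'I_k * nat) : L :=
  d (v t.1 (m t.1).-1) *: e (v t.1 t.2)
    - d (v t.1 t.2) *: e (v t.1 (m t.1).-1).

(** The relation indexed by [(i, j)] has the coordinate [d (last leaf)] at
    [v i j] and [0] at the other leaves that are not last, so rescaling the
    coordinate by that sign gives the dual family.  It separates, because
    the pairing with a leaf sum also forces the last coordinate to vanish. *)
Lemma leaf_relation_basis (r : seq ('I_k * nat)) :
  uniq r ->
  (forall t, (t \in r) = (t.2 < (m t.1).-1)%N) ->
  basis_of (center R G :&: vtx_space R V C)%VS [seq leaf_relation t | t <- r].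
Proof.
have [v_neq0 v_surj _ _] := v_lab => uniq_r mem_r.
have lt_m i j : (j < (m i).-1)%N -> (j < m i)%N.
  by move=> /leq_trans; apply; apply: leq_pred.
apply: (basis_of_biorthogonal (form := inner_form R V C)
  (g := fun t => d (v t.1 (m t.1).-1) *: e (v t.1 t.2))) => //.
- move=> [i j]; rewrite mem_r /= => jm; rewrite memv_cap; apply/andP; split.
    apply/mem_center_star; split.
      rewrite !ffunE !(inj_eq inl_inj) ![v0 == _]eq_sym.
      rewrite !(negPf (v_neq0 _ _ _)) ?last_leaf_lt ?lt_m //.
      by rewrite ![_ *: _]mulr0 subrr.
    move=> i'; rewrite linearBl !linearZl_LR /=.
    rewrite ![inner (e _) _]inner_sym !mul1r /= !inner_leaf.
    rewrite !leaf_sum_leaf ?last_leaf_lt ?lt_m //.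
    by rewrite mulrCA [X in _ - X]mulrCA [X in _ * X]mulrC subrr.
  by apply/mem_vtx_space => z; rewrite !ffunE ![_ *: _]mulr0 subrr.
- move=> [i j] [i' j']; rewrite !mem_r /= => jm jm'.
  rewrite linearZr_LR /= inner_leaf !ffunE !(inj_eq inl_inj).
  rewrite !leaf_eq ?last_leaf_lt ?lt_m //.
  rewrite xpair_eqE ![i == _]eq_sym [j == _]eq_sym.
  case: (eqVneq i' i) => [ii'|] /=; last by rewrite ![_ *: _]mulr0 subrr mulr0.
  rewrite -ii' (ltn_eqF jm') [X in _ - X]mulr0 subr0 mulrA edge_sign_sqr.
  by rewrite mul1r.
move=> x /memv_capP[/mem_center_star[x0 xs] /mem_vtx_space xV] xr.
have xl i j : (j < (m i).-1)%N -> x (inl (v i j)) = 0.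
  move=> jm; have /= := xr (i, j); rewrite mem_r => /(_ jm).
  rewrite linearZr_LR /= inner_leaf => /(congr1 ( *%R (d (v i (m i).-1)))).
  by rewrite mulrA edge_sign_sqr mul1r mulr0.
apply/ffunP => -[u|z]; rewrite [RHS]ffunE //.
have [->//|/v_surj[i [j jm ->]]] := eqVneq u v0.
have := jm; rewrite -(prednK (multiplicity_gt0 (Z i))) ltnS leq_eqVlt.
case/predU1P => [->|/xl//].
have := xs i; rewrite inner_leaf_sum (bigD1 (Ordinal (last_leaf_lt i))) //=.
rewrite big1 => [|j' jj']; last first.
  rewrite xl ?mulr0 // ltn_neqAle -ltnS prednK ?multiplicity_gt0 // ltn_ord.
  by rewrite andbT.
rewrite addr0 => /(congr1 ( *%R (d (v i (m i).-1)))).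
by rewrite mulrA edge_sign_sqr mul1r mulr0.
Qed.

End Star.

(** * Bases of the abelian factor and of the complement of the center *)

Theorem corollary3p3 (R : realType) (V C : finType) (G : elgraph V C)
    (v0 : V) (n k : nat) (Z : 'I_k -> C) (v : 'I_k -> nat -> V) :
  let m (i : 'I_k) : nat := multiplicity G (Z i) in
  let p : nat := (\max_(i < k | 1 < m i) i.+1)%N in
  let d (w : V) : R := edge_sign R G v0 w in
  let e (w : V) : lie_space R V C := vtx R C w in
  let A : seq (lie_space R V C) :=
    [seq d (v i (m i).-1) *: e (v i j) - d (v i j) *: e (v i (m i).-1)
      | i : 'I_k <- [seq i : 'I_k <- enum 'I_k | (i < p)%N],
        j : nat <- iota 0 (m i).-1] in
  let S : seq (lie_space R V C) :=
    e v0 :: [seq (Num.sqrt (m i)%:R)^-1 *: (\sum_(j < m i) d (v i j) *: e (v i j))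
              | i : 'I_k <- enum 'I_k] in
  (0 < n)%N ->
  is_star G v0 n ->
  bijective Z ->
  (forall i i' : 'I_k, (i <= i')%N -> (m i' <= m i)%N) ->
  end_vertex_labeling G v0 Z m v ->
  (exists a : {vspace lie_space R V C},
     unique (is_abelian_factor G) a /\ basis_of a A) /\
  (basis_of (orthov (inner_form R V C) (center R G)) S /\
   orthonormal (inner_form R V C) S).
Proof.
move=> m p d e A S n_gt0 starG Z_bij _ v_lab.
have SE : S = [seq star_frame R G v0 Z v o | o <- frame_indices k].
  by rewrite /S /frame_indices /= -map_comp.
rewrite SE; split; last first.
  split; first exact: star_frame_basis n_gt0 starG Z_bij v_lab.
  exact: star_frame_orthonormal v_lab.
exists (center R G :&: vtx_space R V C)%VS; split.
  exact: unique_abelian_factor (lbl_derived R starG Z_bij v_lab).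
pose r := [seq (i, j) | i <- [seq i : 'I_k <- enum 'I_k | (i < p)%N],
                        j <- iota 0 (m i).-1].
have -> : A = [seq leaf_relation R G v0 Z v t | t <- r].
  by rewrite map_allpairs.
apply: (leaf_relation_basis R n_gt0 starG Z_bij v_lab).
  apply: allpairs_uniq_dep.
  - by rewrite filter_uniq ?enum_uniq.
  - by move=> i _; rewrite iota_uniq.
  by move=> [i j] [i' j'] _ _ /= [-> ->].
move=> [i j]; apply/allpairsPdep/idP => /= [[i' [j' [_ + [-> ->]]]]|jm].
  by rewrite mem_iota.
(* A label with a leaf that is not last has multiplicity at least 2, and [p]
   is beyond the indices of all such labels. *)
exists i, j; split=> //; last by rewrite mem_iota.
rewrite mem_filter mem_enum andbT.
have m_gt1 : (1 < m i)%N by rewrite -ltn_predRL; apply: leq_ltn_trans jm.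
by apply: (bigop.bigmax_sup i).
Qed.
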